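(* Let $G=\mathbb{Z}_2\times\mathbb{Z}_2$, let $F$ be a nontrivial affine latin rumple (i.e. with more than one element), and let $A,B\in\mathrm{Aut}(G,+)$ and $\theta:F\times F\to G$ be given by \[ A=\begin{pmatrix}0&1\\1&0\end{pmatrix},\quad B=\begin{pmatrix}1&0\\1&1\end{pmatrix},\quad \theta(x,y)=\begin{pmatrix}0\\ \beta(x,y)\end{pmatrix},\quad \beta(x,y)=\begin{cases}1&\text{if }x=y,\\0&\text{otherwise.}\end{cases}\] Let $X$ be the set $G\times F$ with the operation $(a,x)*(b,y)=(A(a)+B(b)+\theta(x,y),\,xy)$. Then $X$ is a latin rumple and its displacement group $\mathrm{Dis}(X)$ is nonabelian. In particular, $X$ is not affine.
   Context: Elements of $G$ are written as column vectors over $\mathbb{Z}_2$. A left quasigroup is a binary algebra in which all left translations $L_x:y\mapsto xy$ are bijections; a quasigroup is one in which also all right translations $R_x:y\mapsto yx$ are bijections. A rumple is a left quasigroup whose squaring map is a bijection and which satisfies $(xy)(xz)=(yx)(yz)$ for all $x,y,z$. A latin rumple is a rumple that is a quasigroup. A binary algebra $(H,* )$ is affine if there exist an abelian group structure $(H,+)$ on $H$, endomorphisms $\varphi,\psi$ of $(H,+)$ and $c\in H$ such that $x*y=\varphi(x)+\psi(y)+c$ for all $x,y\in H$. $\mathrm{Dis}(X)=\langle L_xL_y^{-1},\,L_x^{-1}L_y: x,y\in X\rangle$. *)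

(* Defs.v *)
From mathcomp Require Import all_boot all_algebra.
From mathcomp Require Import boolp.
Set Implicit Arguments.
Unset Strict Implicit.
Unset Printing Implicit Defensive.
Import GRing.Theory.
Local Open Scope ring_scope.

Section BinaryAlgebras.
Variables (X : Type) (op : X -> X -> X).

Definition left_quasigroup := forall x, bijective (op x).

Definition quasigroup := left_quasigroup /\ forall x, bijective (op^~ x).

Definition rumple :=
  [/\ left_quasigroup,
      bijective (fun x => op x x)
    & forall x y z, op (op x y) (op x z) = op (op y x) (op y z)].

Definition latin_rumple := rumple /\ quasigroup.

(* [GRing.Zmodule X] is the type of abelian group structures with carrier X.
   It also packs equality and choice operators on X; every type has these
   classically, and affinity does not depend on which ones are taken. *)
Definition affine :=
  exists Z : GRing.Zmodule X,
  let V : zmodType := GRing.Zmodule.Pack Z in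
  exists (phi psi : {additive V -> V}) (c : V),
    forall x y : V, op x y = phi x + psi y + c.

(* X may be infinite, so permutation groups of X are given as sets of maps
   X -> X and inverses by mutual cancellation. *)
Definition inverse_maps (f g : X -> X) := cancel f g /\ cancel g f.

Inductive generated (S : (X -> X) -> Prop) : (X -> X) -> Prop :=
| generated_mem f : S f -> generated S f
| generated_id : generated S id
| generated_comp f g : generated S f -> generated S g -> generated S (f \o g)
| generated_inv f g : generated S f -> inverse_maps f g -> generated S g.

Definition displacement (f : X -> X) :=
  exists (x y : X) (g : X -> X),
    (inverse_maps (op y) g /\ f = op x \o g) \/
    (inverse_maps (op x) g /\ f = g \o op y).

Definition Dis : (X -> X) -> Prop := generated displacement.

Definition commutative_maps (D : (X -> X) -> Prop) :=
  forall f g, D f -> D g -> f \o g = g \o f.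

End BinaryAlgebras.

Notation G := 'cV['Z_2]_2.

Definition col2 (a b : 'Z_2) : G := \col_i nth 0 [:: a; b] i.

Definition mx2 (a b c d : 'Z_2) : 'M['Z_2]_2 :=
  \matrix_(i, j) nth 0 (nth [::] [:: [:: a; b]; [:: c; d]] i) j.

Definition A : 'M['Z_2]_2 := mx2 0 1
                                 1 0.

Definition B : 'M['Z_2]_2 := mx2 1 0
                                 1 1.

Lemma A_unit : A \in unitmx.
Proof. by rewrite unitmxE (expand_det_row _ 0) !big_ord_recl big_ord0 /cofactor !det_mx11 !mxE. Qed.

Lemma B_unit : B \in unitmx.
Proof. by rewrite unitmxE (expand_det_row _ 0) !big_ord_recl big_ord0 /cofactor !det_mx11 !mxE. Qed.

Section Extension.
Variables (F : Type) (op : F -> F -> F).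

Definition beta (x y : F) : 'Z_2 := if `[< x = y >] then 1 else 0.

Definition theta (x y : F) : G := col2 0 (beta x y).

Definition extension_op (u v : G * F) : G * F :=
  (A *m u.1 + B *m v.1 + theta u.2 v.2, op u.2 v.2).

End Extension.

(* Main.v *)
Require Import Defs.
From mathcomp Require Import all_boot all_algebra.
From mathcomp Require Import boolp.

(** The rumple law of the extension reduces to [A^2 + BA = AB], [B theta = theta]
    and the invariance of [beta] under left translations of [F].

    For the displacement group, take [u <> 0] in [F] and [v] with
    [phi v = psi u]; the rumple law of [F] and the injectivity of squaring give
    [phi u <> psi v]. Writing [L_x] for the translation by [(0, x)], the
    displacements [L_u L_0^-1] and [L_v L_0^-1] do not commute: evaluated at
    [L_0 (0, 0)], one product meets the diagonal of [beta] and the other does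
    not. For an affine algebra, in contrast, every element of [Dis] is an
    additive translation. *)

Set Implicit Arguments.
Unset Strict Implicit.
Unset Printing Implicit Defensive.
Import GRing.Theory.
Local Open Scope ring_scope.

(** All left translations share the part [psi y + c], so any two of them differ by an additive
    constant. *)
Lemma affine_Dis_translation (V : zmodType) (phi psi : {additive V -> V})
    (c : V) (op : V -> V -> V) (f : V -> V) :
  (forall x y, op x y = phi x + psi y + c) -> Dis op f ->
  exists t, forall w, f w = w + t.
Proof.
move=> opE; elim => {f}
  [f [x [y [g [[[_ gK] ->]|[[gK Kg] ->]]]]]||f g _ [s fE] _ [t gE]|
   f g _ [t fE] [_ gK]].
- exists (phi x - phi y) => w /=.
  by rewrite -{2}[w]gK !opE [RHS]addrC -!addrA addKr.
(* A translation is determined by its value at [0]; this witness avoids inverting [psi]. *)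
- exists (g (op y 0)) => w /=.
  apply: (can_inj gK); rewrite Kg [RHS]opE raddfD.
  have := Kg (op y 0); rewrite !opE raddf0 addr0 => /addIr e.
  by rewrite [psi w + _]addrC addrA e.
- by exists 0 => w; rewrite addr0.
- by exists (t + s) => w /=; rewrite gE fE addrA.
- by exists (- t) => w; rewrite -{2}[w]gK fE addrK.
Qed.

Lemma affine_Dis_commutative (X : Type) (op : X -> X -> X) :
  affine op -> commutative_maps (Dis op).
Proof.
case=> Z [phi [psi [c opE]]] f g.
move=> /(@affine_Dis_translation (GRing.Zmodule.Pack Z) _ _ _ _ _ opE)[s fE].
move=> /(@affine_Dis_translation (GRing.Zmodule.Pack Z) _ _ _ _ _ opE)[t gE].
by apply/funext => w /=; rewrite !(fE, gE) addrAC.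
Qed.

(** The map is triangular: invert [f] first, then the fibre coordinate. Left translations, right
    translations and squaring of the extension have this shape, with [M] equal to [B], [A] and
    [A + B]. *)
Lemma bijective_skew (R : comUnitRingType) (n : nat) (T : Type)
    (M : 'M[R]_n) (h : T -> 'cV[R]_n) (f : T -> T) :
  M \in unitmx -> bijective f ->
  bijective (fun v : 'cV[R]_n * T => (M *m v.1 + h v.2, f v.2)).
Proof.
move=> Mu [g gK Kg].
exists (fun w => (invmx M *m (w.1 - h (g w.2)), g w.2)) => [[a x]|[a x]] /=.
  by rewrite gK addrK mulKmx.
by rewrite Kg mulKVmx // subrK.
Qed.

Lemma mulBB : B *m B = 1%:M.
Proof.
apply/matrixP => i j; rewrite !mxE !big_ord_recl big_ord0 !mxE.
by apply/eqP; case: i j => [[|[|[]]] //= ?] [[|[|[]]] //= ?].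
Qed.

Lemma mulAA_BA : A *m A + B *m A = A *m B.
Proof.
apply/matrixP => i j; rewrite !mxE !big_ord_recl !big_ord0 !mxE.
by apply/eqP; case: i j => [[|[|[]]] //= ?] [[|[|[]]] //= ?].
Qed.

Lemma AB_unit : A + B \in unitmx.
Proof.
by rewrite unitmxE (expand_det_row _ 0) !big_ord_recl big_ord0 /cofactor
           !det_mx11 !mxE.
Qed.

Lemma mulB_col2 (b : 'Z_2) : B *m col2 0 b = col2 0 b.
Proof.
apply/matrixP => i j; rewrite !mxE !big_ord_recl !big_ord0 !mxE.
by case: i => [[|[|[]]] //= ?]; rewrite ?mul0r ?mulr0 ?mul1r ?add0r ?addr0.
Qed.

Lemma col2_inj a b : col2 0 a = col2 0 b -> a = b.
Proof. by move=> /matrixP /(_ (lift ord0 ord0) 0); rewrite !mxE. Qed.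

Lemma betaC (F : Type) (x y : F) : beta x y = beta y x.
Proof. by rewrite /beta (_ : (x = y) = (y = x)) //; apply/propext; split. Qed.

Lemma beta_refl (F : Type) (x : F) : beta x x = 1.
Proof. by rewrite /beta; case: asboolP. Qed.

Lemma beta_neq (F : Type) (x y : F) : x <> y -> beta x y = 0.
Proof. by rewrite /beta; case: asboolP. Qed.

Lemma beta_inj (F : Type) (f : F -> F) (x y : F) :
  injective f -> beta (f x) (f y) = beta x y.
Proof.
by move=> fI; rewrite /beta (_ : (f x = f y) = (x = y)) //;
   apply/propext; split=> [/fI|->].
Qed.

Section Extension.
Variables (F : Type) (op : F -> F -> F).
Hypothesis F_latin_rumple : latin_rumple op.

Lemma extension_left : left_quasigroup (extension_op op).
Proof.
case: F_latin_rumple => _ [opL _] [a x].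
apply: (eq_bij (bijective_skew (fun y => A *m a + theta x y) B_unit (opL x))).
by move=> [b y] /=; rewrite /extension_op /= addrA [B *m b + _]addrC.
Qed.

Lemma extension_right v : bijective ((extension_op op)^~ v).
Proof.
case: F_latin_rumple => _ [_ opR]; case: v => b y.
apply: (eq_bij (bijective_skew (fun x => B *m b + theta x y) A_unit (opR y))).
by move=> [a x] /=; rewrite /extension_op /= addrA.
Qed.

Lemma extension_square : bijective (fun u => extension_op op u u).
Proof.
case: F_latin_rumple => [[_ opS _] _].
apply: (eq_bij (bijective_skew (fun x => theta x x) AB_unit opS)).
by move=> [a x] /=; rewrite /extension_op /= mulmxDl.
Qed.

Lemma extension_rumple_law u v w (xop := extension_op op) :
  xop (xop u v) (xop u w) = xop (xop v u) (xop v w).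
Proof.
case: F_latin_rumple => [[opL _ opE] _].
case: u v w => [a x] [b y] [d z]; rewrite /xop /extension_op /= opE.
congr pair; rewrite !mulmxDr !mulmxA /theta !mulB_col2 mulBB !mul1mx.
rewrite !(beta_inj _ _ (bij_inj (opL _))) (betaC y x).
rewrite -mulAA_BA !mulmxDl !addrA.
(* The sides now differ by swapping the two [A *m A] terms, the two [B *m A] terms and the last two
   values of [theta]. *)
by rewrite [LHS](ACl (2*1*5*4*3*6*8*7)).
Qed.

Lemma extension_latin_rumple : latin_rumple (extension_op op).
Proof.
split; [split|split].
- exact: extension_left.
- exact: extension_square.
- exact: extension_rumple_law.
- exact: extension_left.
- exact: extension_right.
Qed.

End Extension.

(** The rumple law gives [phi phi + psi phi = phi psi]. Used at [v] and then at [u], it yields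
    [psi (phi u + psi u) = 0], so [u] and [0] have the same square. *)
Lemma affine_rumple_asymmetry (V : zmodType) (phi psi : {additive V -> V})
    (c : V) (op : V -> V -> V) (u v : V) :
  (forall x y, op x y = phi x + psi y + c) -> rumple op ->
  phi v = psi u -> phi u = psi v -> u = 0.
Proof.
move=> opE [opL opS opR] vu uv.
have law x : phi (phi x) + psi (phi x) = phi (psi x).
  move: (opR x 0 0); rewrite !opE !raddfD !raddf0 !add0r !addr0.
  set p := phi c; set q := psi c; move=> /addIr; rewrite addrA => /addIr.
  by rewrite addrAC => /addIr.
have psiI : injective psi.
  by move=> x y e; apply: (bij_inj (opL 0)); rewrite !opE e.
apply: (bij_inj opS); rewrite !opE !raddf0 !add0r -[RHS]add0r; congr (_ + _).
apply: psiI; rewrite raddfD raddf0; have := law v.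
by rewrite vu -uv -(law u) -addrA -[RHS]addr0 => /addrI.
Qed.

(** At [L e (0, e)] the two products take the values [L u (0, u)] and [L v (0, w)], whose fibre
    parts are given by [beta u u = 1] and [beta v w = 0]. *)
Lemma extension_Dis_noncommutative (F : Type) (op : F -> F -> F) (e u v w : F) :
  latin_rumple op -> u <> e ->
  op v e = op e u -> op u e = op e w -> v <> w ->
  ~ commutative_maps (Dis (extension_op op)).
Proof.
move=> Fr ue vu uw vw Dcomm.
have [g gK Kg] := extension_left Fr (0, e).
pose L x := extension_op op (0, x).
have disp x : Dis (extension_op op) (L x \o g).
  by apply: generated_mem; exists (0, x), (0, e), g; left.
have opI x : injective (op x) by case: Fr => [[opL _ _] _]; apply: bij_inj.
have opIr x : injective (op^~ x) by case: Fr => [_ [_ opR]]; apply: bij_inj.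
have LE x y : L x (0, y) = (col2 0 (beta x y), op x y).
  by rewrite /L /extension_op /= !mulmx0 !add0r.
have ve : v <> e by move=> ve; apply: ue; apply: (opI e); rewrite -vu ve.
have we : w <> e by move=> we; apply: ue; apply: (opIr e) => /=; rewrite uw we.
(* Away from [e] both values of [beta] vanish, so [L x (0, e) = L e (0, y)]. *)
have gL x y : op x e = op e y -> x <> e -> y <> e -> g (L x (0, e)) = (0, y).
  move=> xy xe ye; apply: (can_inj gK).
  by rewrite Kg -/(L e) !LE !beta_neq ?xy // => /esym.
have := congr1 (@^~ (L e (0, e))) (Dcomm _ _ (disp u) (disp v)).
rewrite (_ : (_ \o _) _ = L u (g (L v (0, e)))); last by rewrite /= gK.
rewrite (_ : (_ \o _) _ = L v (g (L u (0, e)))); last by rewrite /= gK.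
by rewrite (gL v u) // (gL u w) // !LE beta_refl beta_neq // => -[/col2_inj].
Qed.

Theorem lemma6p3 (F : Type) (op : F -> F -> F)
    (F_nontrivial : exists x y : F, x <> y)
    (F_affine : affine op)
    (F_latin_rumple : latin_rumple op) :
  [/\ latin_rumple (extension_op op),
      ~ commutative_maps (Dis (extension_op op))
    & ~ affine (extension_op op)].
Proof.
suff nD : ~ commutative_maps (Dis (extension_op op)).
  by split=> //; [exact: extension_latin_rumple | move=> /affine_Dis_commutative].
case: F_affine => Z [phi [psi [c opE]]].
pose V : zmodType := GRing.Zmodule.Pack Z.
have [[opL _ _] [_ opR]] := F_latin_rumple.
have [u u0] : exists u : V, u <> 0.
  case: F_nontrivial => x [y xy]; have [x0|] := pselect (x = 0 :> V).
    by exists y => y0; apply: xy; rewrite x0 y0.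
  by exists x.
(* Dividing by [0] on either side solves [phi v = psi u] by [v = r (op 0 u)] and [psi w = phi u] by
   [w = l (op u 0)]. *)
have [l _ Kl] := opL (0 : V); have [r _ Kr] := opR (0 : V).
apply: (@extension_Dis_noncommutative F op (0 : V) u
          (r (op (0 : V) u)) (l (op u (0 : V)))) => //.
(* If [v = w], both equations of the asymmetry lemma hold, forcing [u = 0]. *)
move=> vw; apply: u0.
apply: (@affine_rumple_asymmetry V phi psi c op u (r (op (0 : V) u)) opE).
- by case: F_latin_rumple.
- have := Kr (op (0 : V) u); rewrite /= !opE !raddf0 add0r addr0.
  exact: (@addIr V c).
- have := Kl (op u (0 : V)); rewrite -vw !opE !raddf0 !add0r addr0.
  by move=> /(@addIr V c).
Qed.
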